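(* Let $\alpha$ be an infinite ordinal. There is an atomic algebra $\mathfrak A\in SA_\alpha$ such that $\mathfrak A$ is not completely representable.
   Context: For distinct $i,j\in\alpha$, $[i,j]$ is the transposition of $\alpha$ swapping $i$ and $j$, and $[i|j]$ is the map $\alpha\to\alpha$ sending $i$ to $j$ and fixing everything else. For a set $U$, a set $V\subseteq{}^\alpha U$ is locally square if $s\circ[i|j],\,s\circ[i,j]\in V$ for all $s\in V$ and $i\neq j\in\alpha$; then $\wp(V)=\langle\mathcal P(V);\cap,\sim,S^i_j,S_{ij}\rangle_{i\ne j\in\alpha}$ with $\sim$ complement in $V$, $S^i_j(X)=\{q\in V:q\circ[i|j]\in X\}$ and $S_{ij}(X)=\{q\in V:q\circ[i,j]\in X\}$. For finite $n\geq 2$, $\Sigma_n$ is the following finite set of equations in the type $\{\cdot,-,s^i_j,s_{ij}\}_{i\ne j\in n}$: (a) the Boolean algebra axioms; (b) each $s_{ij}$ and each $s^i_j$ is a Boolean endomorphism; (c) for a fixed finite presentation of the monoid ${}^nn$ (all maps $n\to n$ under composition) in the generators $[i,j],[i|j]$, all equations $s_{g_1}\cdots s_{g_m}x=s_{h_1}\cdots s_{h_k}x$ for the defining relations $g_1\circ\cdots\circ g_m=h_1\circ\cdots\circ h_k$, where $s_{[i,j]}=s_{ij}$, $s_{[i|j]}=s^i_j$. $\Sigma_\alpha$ is the set of all equations in the type $\{\cdot,-,s^i_j,s_{ij}\}_{i\neq j\in\alpha}$ obtained from equations in $\Sigma_n$, $2\le n<\omega$, by replacing the indices along an injection $\rho:n\to\alpha$.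 $SA_\alpha=\mathbf{Mod}(\Sigma_\alpha)$. A representation of $\mathfrak A$ is an injective homomorphism $f:\mathfrak A\to\wp(V)$ with $V$ locally square; it is complete if $f(\prod X)=\bigcap_{x\in X}f(x)$ for every $X\subseteq\mathfrak A$ whose meet $\prod X$ exists in $\mathfrak A$. $\mathfrak A$ is completely representable if it has a complete representation. *)

(* Defs.v *)
From Stdlib Require List.
From mathcomp Require Import all_boot.
From mathcomp Require Import boolp classical_sets functions cardinality.
From mathcomp Require wochoice.

Set Implicit Arguments.
Unset Strict Implicit.
Unset Printing Implicit Defensive.

Local Open Scope classical_set_scope.

Definition distinct_pair (I : eqType) := {p : I * I | p.1 != p.2}.

(* [Repl p] and [Swap p], for [p = (i, j)], name both the maps [i|j], [i,j] and
   the operation symbols s^i_j, s_ij. *)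
Inductive gen (I : eqType) :=
  | Repl of distinct_pair I
  | Swap of distinct_pair I.

Definition gen_map (I : eqType) (g : gen I) : I -> I :=
  match g with
  | Repl p => [eta id with (val p).1 |-> (val p).2]
  | Swap p => [eta id with (val p).1 |-> (val p).2, (val p).2 |-> (val p).1]
  end.

Lemma distinct_pair_image (I J : eqType) (rho : I -> J) (inj : injective rho)
  (p : distinct_pair I) : rho (val p).1 != rho (val p).2.
Proof. by rewrite (inj_eq inj) (valP p). Qed.

Definition rename_pair (I J : eqType) (rho : I -> J) (inj : injective rho)
    (p : distinct_pair I) : distinct_pair J :=
  exist _ (rho (val p).1, rho (val p).2) (distinct_pair_image inj p).

Definition rename_gen (I J : eqType) (rho : I -> J) (inj : injective rho)
    (g : gen I) : gen J :=
  match g with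
  | Repl p => Repl (rename_pair inj p)
  | Swap p => Swap (rename_pair inj p)
  end.

(* The word [:: g_1; ...; g_m] denotes g_1 \o ... \o g_m. *)
Definition word (I : eqType) := seq (gen I).

Definition word_map (I : eqType) (w : word I) : I -> I :=
  foldr (fun g h => gen_map g \o h) id w.

Inductive word_cong (I : eqType) (rels : set (word I * word I)) :
    word I -> word I -> Prop :=
  | word_cong_rel u v : rels (u, v) -> word_cong rels u v
  | word_cong_refl u : word_cong rels u u
  | word_cong_sym u v : word_cong rels u v -> word_cong rels v u
  | word_cong_trans u v w :
      word_cong rels u v -> word_cong rels v w -> word_cong rels u w
  | word_cong_cat u u' v v' :
      word_cong rels u u' -> word_cong rels v v' ->
      word_cong rels (u ++ v) (u' ++ v').

(* [rels] is a set of defining relations, in the generators [gen I], of the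
   monoid of all maps I -> I. *)
Definition finite_presentation (I : eqType) (rels : set (word I * word I)) :=
  [/\ finite_set rels,
      forall f : I -> I, exists w, word_map w =1 f
    & forall u v, word_cong rels u v <-> word_map u =1 word_map v].

Inductive term (I : eqType) :=
  | Var of nat
  | Meet of term I & term I
  | Compl of term I
  | Subst of gen I & term I.

Arguments Var {I}.

Definition equation (I : eqType) := (term I * term I)%type.

Fixpoint rename_term (I J : eqType) (rho : I -> J) (inj : injective rho)
    (t : term I) : term J :=
  match t with
  | Var k => Var k
  | Meet t1 t2 => Meet (rename_term inj t1) (rename_term inj t2)
  | Compl t1 => Compl (rename_term inj t1)
  | Subst g t1 => Subst (rename_gen inj g) (rename_term inj t1)
  end.

Definition rename_equation (I J : eqType) (rho : I -> J) (inj : injective rho)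
    (e : equation I) : equation J :=
  (rename_term inj e.1, rename_term inj e.2).

Definition Join (I : eqType) (t1 t2 : term I) : term I :=
  Compl (Meet (Compl t1) (Compl t2)).

(* Complemented distributive lattices, with join defined by De Morgan's law,
   bottom the common value of all x . -x and top the common value of all x + -x.
   *)
Definition boolean_axioms (I : eqType) : set (equation I) :=
  let x := @Var I 0 in let y := @Var I 1 in let z := @Var I 2 in
  [set e | List.In e [::
    (Meet x y, Meet y x);
    (Join x y, Join y x);
    (Meet x (Meet y z), Meet (Meet x y) z);
    (Join x (Join y z), Join (Join x y) z);
    (Meet x (Join x y), x);
    (Join x (Meet x y), x);
    (Meet x (Join y z), Join (Meet x y) (Meet x z));
    (Join x (Meet y z), Meet (Join x y) (Join x z));
    (Join (Meet x (Compl x)) y, y);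
    (Meet (Join x (Compl x)) y, y)]].

Definition endomorphism_axioms (I : eqType) : set (equation I) :=
  let x := @Var I 0 in let y := @Var I 1 in
  [set e | exists g : gen I,
    e = (Subst g (Meet x y), Meet (Subst g x) (Subst g y)) \/
    e = (Subst g (Compl x), Compl (Subst g x))].

Definition subst_word (I : eqType) (w : word I) (t : term I) : term I :=
  foldr (@Subst I) t w.

Definition relation_axioms (I : eqType) (rels : set (word I * word I)) :
    set (equation I) :=
  [set (subst_word r.1 (Var 0), subst_word r.2 (Var 0)) | r in rels].

Definition Sigma_fin (n : nat) (rels : set (word 'I_n * word 'I_n)) :
    set (equation 'I_n) :=
  @boolean_axioms 'I_n `|` @endomorphism_axioms 'I_n `|` relation_axioms rels.

Definition Sigma (pres : forall n : nat, set (word 'I_n * word 'I_n))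
    (alpha : eqType) : set (equation alpha) :=
  [set e | exists n (rho : 'I_n -> alpha) (inj : injective rho) e0,
    [/\ 2 <= n, Sigma_fin (pres n) e0 & e = rename_equation inj e0]].

Record algebra (alpha : eqType) := Algebra {
  carrier :> Type;
  carrier_inhabited : inhabited carrier;
  meet : carrier -> carrier -> carrier;
  compl : carrier -> carrier;
  subst : gen alpha -> carrier -> carrier
}.

Fixpoint eval (alpha : eqType) (A : algebra alpha) (env : nat -> A)
    (t : term alpha) : A :=
  match t with
  | Var k => env k
  | Meet t1 t2 => meet (eval env t1) (eval env t2)
  | Compl t1 => compl (eval env t1)
  | Subst g t1 => subst g (eval env t1)
  end.

Definition model (alpha : eqType) (E : set (equation alpha))
    (A : algebra alpha) :=
  forall e, E e -> forall env : nat -> A, eval env e.1 = eval env e.2.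

Definition SA (pres : forall n : nat, set (word 'I_n * word 'I_n))
    (alpha : eqType) (A : algebra alpha) :=
  model (Sigma pres (alpha := alpha)) A.

Definition le (alpha : eqType) (A : algebra alpha) (x y : A) := meet x y = x.

Definition is_bottom (alpha : eqType) (A : algebra alpha) (x : A) :=
  forall y, le x y.

Definition is_atom (alpha : eqType) (A : algebra alpha) (a : A) :=
  ~ is_bottom a /\ forall x, le x a -> is_bottom x \/ x = a.

Definition atomic (alpha : eqType) (A : algebra alpha) :=
  forall x : A, ~ is_bottom x -> exists2 a, is_atom a & le a x.

Definition is_inf (alpha : eqType) (A : algebra alpha) (X : set A) (m : A) :=
  (forall x, X x -> le m x) /\
  (forall y, (forall x, X x -> le y x) -> le y m).

Definition locally_square (alpha : eqType) (U : Type) (V : set (alpha -> U)) :=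
  forall s, V s -> forall g : gen alpha, V (s \o gen_map g).

Section PowerSetAlgebra.
Context (alpha : eqType) (U : Type) (V : set (alpha -> U)).

Definition subset_of := {X : set (alpha -> U) | X `<=` V}.

Definition pow_meet (X Y : subset_of) : subset_of :=
  exist _ (sval X `&` sval Y) (subIset (or_introl (proj2_sig X))).

Definition pow_compl (X : subset_of) : subset_of :=
  exist _ (V `\` sval X) (@subDsetl _ V (sval X)).

Definition pow_subst (g : gen alpha) (X : subset_of) : subset_of :=
  exist _ (V `&` [set q : alpha -> U | sval X (q \o gen_map g)]) (@subIsetl _ V _).

Definition pow_algebra : algebra alpha :=
  @Algebra alpha subset_of (inhabits (exist (subset^~ V) V (@subset_refl _ V)))
    pow_meet pow_compl pow_subst.

End PowerSetAlgebra.

Definition homomorphism (alpha : eqType) (A B : algebra alpha) (f : A -> B) :=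
  [/\ {morph f : x y / meet x y},
      {morph f : x / compl x}
    & forall g, {morph f : x / subst g x}].

Definition representation (alpha : eqType) (A : algebra alpha) (U : Type)
    (V : set (alpha -> U)) (f : A -> pow_algebra V) :=
  [/\ locally_square V, homomorphism f & injective f].

(* The intersection with [V] only matters when [X] is empty: the intersection
   of the empty family of subsets of [V] is [V]. *)
Definition complete (alpha : eqType) (A : algebra alpha) (U : Type)
    (V : set (alpha -> U)) (f : A -> pow_algebra V) :=
  forall (X : set A) (m : A), is_inf X m ->
    sval (f m) = V `&` \bigcap_(x in X) sval (f x).

Definition completely_representable (alpha : eqType) (A : algebra alpha) :=
  exists (U : Type) (V : set (alpha -> U)) (f : A -> pow_algebra V),
    representation f /\ complete f.

(* Main.v *)
Require Import Defs.
From mathcomp Require Import all_boot.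
From mathcomp Require Import boolp classical_sets functions cardinality filter.
From mathcomp Require wochoice.

(** The powerset of [nat] carries a Boolean endomorphism [e] sending the members
    of a nonprincipal ultrafilter [G] to the top and all other sets to the
    bottom. It is idempotent, so letting every s_ij act as the identity and
    every s^i_j as [e] yields an action of the finite transformation monoids:
    a word acts as the identity or as [e] according to whether the map it
    denotes is injective. In a locally square powerset algebra every s^i_j
    preserves intersections, whereas [e] is top on each complement of a
    singleton and bottom on the intersection of these complements; so no
    representation is complete. *)

Set Implicit Arguments.
Unset Strict Implicit.
Unset Printing Implicit Defensive.

Local Open Scope classical_set_scope.

Lemma ultra_setC (T : Type) (F : set_system T) (X : set T) :
  UltraFilter F -> F (~` X) = ~ F X.
Proof.
move=> FU; apply/propext; split=> [FXC FX|nFX].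
- have : F (~` X `&` X) by exact: filterI.
  by case/filter_ex=> t [].
- by case: (in_ultra_setVsetC X FU).
Qed.

Lemma filter_setI (T : Type) (F : set_system T) (X Y : set T) :
  Filter F -> F (X `&` Y) = (F X /\ F Y).
Proof.
move=> FF; apply/propext; split=> [FXY|[FX FY]]; last exact: filterI.
by split; apply: filterS FXY => t [].
Qed.

Lemma setC_setIC (T : Type) (X Y : set T) : ~` (~` X `&` ~` Y) = X `|` Y.
Proof. by rewrite setCI !setCK. Qed.

Definition is_repl (I : eqType) (g : gen I) : bool :=
  if g is Repl _ then true else false.

Section UltrafilterAlgebra.
Context (alpha : eqType) (G : set (set nat)) (GU : UltraFilter G).

Definition ultra_endo (X : set nat) : set nat := [set _ | G X].

Lemma ultra_endoI (X Y : set nat) :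
  ultra_endo (X `&` Y) = ultra_endo X `&` ultra_endo Y.
Proof. by apply/funext => n; apply: filter_setI. Qed.

Lemma ultra_endoC (X : set nat) : ultra_endo (~` X) = ~` ultra_endo X.
Proof. by apply/funext => n; apply: ultra_setC. Qed.

(** The set [ultra_endo X] is [setT] or [set0]; a proper filter contains the former and not the
    latter, so both are fixed. *)
Lemma ultra_endo_idem (X : set nat) : ultra_endo (ultra_endo X) = ultra_endo X.
Proof.
rewrite /ultra_endo; case: (pselect (G X)) => GX.
- by rewrite (_ : [set _ | G X] = setT) //;
    apply/seteqP; split=> // n _ /=; apply: filterT.
- rewrite (_ : [set _ | G X] = set0); last by apply/seteqP; split.
  by apply/seteqP; split=> // n /=; apply: filter_not_empty.
Qed.

Definition ultra_algebra : algebra alpha :=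
  @Algebra alpha (set nat) (inhabits set0) (@setI nat) (@setC nat)
    (fun g X => if is_repl g then ultra_endo X else X).

(** Swaps act trivially, and by idempotence all replacements in a word collapse into one. *)
Lemma ultra_eval_subst_word (I : eqType) (rho : I -> alpha)
    (inj : injective rho) (w : word I) (env : nat -> ultra_algebra) :
  eval env (rename_term inj (subst_word w (Var 0))) =
  if has (@is_repl I) w then ultra_endo (env 0%N) else env 0%N.
Proof.
elim: w => //= g w IHw; rewrite IHw.
by case: g => p //=; case: has => //; rewrite ultra_endo_idem.
Qed.

Lemma ultra_boolean (I : eqType) (rho : I -> alpha) (inj : injective rho)
    (e : equation I) (env : nat -> ultra_algebra) :
  boolean_axioms e ->
  eval env (rename_term inj e.1) = eval env (rename_term inj e.2).
Proof.
case=> [<-|[<-|[<-|[<-|[<-|[<-|[<-|[<-|[<-|[<-|[]]]]]]]]]]];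
  rewrite //= ?setC_setIC.
- exact: setIC.
- exact: setUC.
- exact: setIA.
- exact: setUA.
- by apply: setIidl => n; left.
- by apply: setUidl => n [].
- exact: setIUr.
- exact: setUIr.
- by rewrite setICr set0U.
- by rewrite setUCr setTI.
Qed.

Lemma ultra_endomorphism (I : eqType) (rho : I -> alpha) (inj : injective rho)
    (e : equation I) (env : nat -> ultra_algebra) :
  endomorphism_axioms e ->
  eval env (rename_term inj e.1) = eval env (rename_term inj e.2).
Proof.
case=> -[] p [] -> //=; [exact: ultra_endoI | exact: ultra_endoC].
Qed.

End UltrafilterAlgebra.

(** If [g \o h] is injective then so is [h], which by finiteness is bijective; hence [g] is
    injective too, so it is not a replacement. Conversely, composites of transpositions are
    injective. *)
Lemma word_map_inj_has_repl (I : finType) (w : word I) :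
  injectiveb (word_map w) = ~~ has (@is_repl I) w.
Proof.
elim: w => [|g w IHw] /=; first by apply/injectiveP.
rewrite negb_or -IHw.
apply/injectiveP/andP => [gw_inj|[g_bij /injectiveP w_inj]].
- have w_inj : injective (word_map w).
    by move=> x y /(congr1 (gen_map g))/gw_inj.
  split; last exact/injectiveP.
  case: g gw_inj => // -[[i j] /= ij] gw_inj.
  (* The composite identifies the preimages of [i] and [j] under [word_map w], since [i|j] sends
     both [i] and [j] to [j]. *)
  have [w' _ wK] := injF_bij w_inj.
  have := gw_inj (w' i) (w' j); rewrite /= !wK /= eqxx eq_sym.
  rewrite (negPf ij) => /(_ erefl) /(congr1 (word_map w)); rewrite !wK => eij.
  by rewrite eij eqxx in ij.
- case: g g_bij => // -[[i j] /= ij] _; apply: inj_comp w_inj.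
  (* A transposition is its own inverse. *)
  apply: (can_inj (g := gen_map (Swap (exist _ (i, j) ij)))) => x /=.
  case: (eqVneq x i) => [->|xi]; first by rewrite eq_sym (negPf ij) eqxx.
  by case: (eqVneq x j) => [->|xj]; rewrite ?eqxx ?(negPf xi) ?(negPf xj).
Qed.

Lemma ultra_SA (pres : forall n : nat, set (word 'I_n * word 'I_n))
    (alpha : eqType) (G : set (set nat)) (GU : UltraFilter G) :
  (forall n : nat, 2 <= n -> finite_presentation (pres n)) ->
  SA pres (ultra_algebra alpha G).
Proof.
move=> hpres _ [n [rho [inj [e [n2 ax ->]]]]] env.
case: ax => [[|]|[[u v] /= uv <-]] /=; first exact: ultra_boolean.
  exact: ultra_endomorphism.
rewrite !ultra_eval_subst_word.
(* The two sides of a defining relation denote the same map, so injectivity of that map decides for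
   both whether a replacement occurs. *)
have [_ _ /(_ u v) [+ _]] := hpres n n2.
move=> /(_ (word_cong_rel uv)) uv_map.
rewrite -[has _ u]negbK -[has _ v]negbK -!word_map_inj_has_repl.
suff -> : injectiveb (word_map u) = injectiveb (word_map v) by [].
by apply/injectiveP/injectiveP => /eq_inj; apply=> // i; rewrite uv_map.
Qed.

Lemma ultra_atomic (alpha : eqType) (G : set (set nat)) :
  atomic (ultra_algebra alpha G).
Proof.
move=> X nbX; case: (pselect (X !=set0)) => [[n Xn]|/nonemptyPn X0].
- exists [set n]; last by apply: setIidl => _ ->.
  split=> [/(_ set0) /setIidPl /(_ n erefl) //|Y /setIidPl /subset_set1].
  by case=> ->; [left=> Z; exact: set0I|right].
- by case: nbX => Y; rewrite X0; apply: set0I.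
Qed.

Lemma representation_le (alpha : eqType) (A : algebra alpha) (U : Type)
    (V : set (alpha -> U)) (f : A -> pow_algebra V) (x y : A) :
  representation f -> (le x y <-> sval (f x) `<=` sval (f y)).
Proof.
move=> [_ [fI _ _] f_inj]; split=> [<-|fxy].
- by rewrite fI; apply: subIsetr.
- apply: f_inj; rewrite fI; case: (f x) (f y) fxy => X XV [Y YV] /= XY.
  by apply: eq_exist; apply/setIidPl.
Qed.

(** A complete representation turns infima into intersections, and each substitution into a preimage
    under composition with a fixed map; preimages commute with intersections. *)
Lemma completely_representable_subst_inf (alpha : eqType) (A : algebra alpha)
    (g : gen alpha) (X : set A) (m : A) :
  completely_representable A -> is_inf X m ->
  is_inf [set subst g x | x in X] (subst g m).
Proof.
move=> [U [V [f [rep_f complete_f]]]] infXm.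
have fm := complete_f X m infXm.
have [Vg [_ _ fS] _] := rep_f.
split=> [_ [x Xx <-]|y yX]; apply/(representation_le _ _ rep_f); rewrite !fS /=.
- by move=> q [Vq]; rewrite /= fm => -[_ /(_ x Xx)].
- move=> q yq; have Vq : V q := svalP (f y) q yq.
  (* Local squareness gives membership in [V], which is the whole claim when [X] is empty. *)
  split=> //=; rewrite fm; split=> [|x Xx]; first exact: Vg.
  have /(representation_le _ _ rep_f) := yX _ (ex_intro2 _ _ x Xx erefl).
  by rewrite fS => /(_ q yq) [].
Qed.

Theorem theorem3p39
  (pres : forall n : nat, set (word 'I_n * word 'I_n))
  (hpres : forall n : nat, 2 <= n -> finite_presentation (pres n))
  (alpha : eqType) (R : rel alpha) (hR : wochoice.well_order R)
  (halpha : infinite_set [set: alpha]%classic) :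
  exists A : algebra alpha,
    SA pres A /\ atomic A /\ ~ completely_representable A.
Proof.
(* Extending the filter of cofinite sets makes [G] nonprincipal. *)
have [G [GU ooG]] := ultraFilterLemma eventually_filter.
have GF : Filter G by exact: filter_filter.
have [p _] : exists p : distinct_pair alpha, True.
  have [i _] := infinite_setN0 halpha.
  have [j [_ /eqP ji]] : ([set: alpha] `\` [set i]) !=set0.
    by apply/infinite_setN0/infinite_setD => //; apply: finite_set1.
  by exists (exist _ (j, i) ji).
exists (ultra_algebra alpha G); split; first exact: ultra_SA.
split; first exact: ultra_atomic.
move=> crep.
pose X : set (ultra_algebra alpha G) := [set ~` [set n] | n in [set: nat]].
have infX : is_inf X set0.
  split=> [Y _|Y YX]; first exact: set0I.
  apply: setIidl => n Yn.
  by have /setIidPl /(_ n Yn erefl) := YX _ (ex_intro2 _ _ n I erefl).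
(* The images of the members of [X] all equal [setT], so [setT] would lie below the image of [set0],
   which is empty. *)
have [_ /(_ setT)] := completely_representable_subst_inf (Repl p) crep infX.
have -> : @subst _ (ultra_algebra alpha G) (Repl p) set0 = set0.
  by apply/seteqP; split=> // n; apply: filter_not_empty.
have GC n : G (~` [set n]).
  (* Every [k] from [n.+1] on differs from [n]. *)
  by apply: ooG; exists n.+1 => // k /= nk kn; rewrite kn ltnn in nk.
suff topX x : [set subst (Repl p) Y | Y in X] x ->
    le (setT : ultra_algebra alpha G) x.
  by move=> /(_ topX) /setIidPl /(_ 0%N I).
by move=> [_ [n _ <-] <-]; apply: setIidl => k _; apply: GC.
Qed.
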